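(* Let $k',l'\ge 1$ be integers, $n=k'+l'$, $c\in\{1,-1,0\}$, and let $J=\mathrm{diag}(J_1,\dots,J_n)$ be a real diagonal matrix with all $J_i\ne0$. Let $\langle x,y\rangle=\sum_{i=1}^n\tau_ix_iy_i$ with $\tau_i=1$ for $i\le k'$ and $\tau_i=-1$ for $i>k'$, and let $F=\mathrm{diag}(1,\dots,1,\sqrt{-1},\dots,\sqrt{-1})$ (with $k'$ entries $1$ and $l'$ entries equal to the imaginary unit). Let $(q_k)_{k\in\mathbb Z}$ be a sequence of points of $\mathbb R^n$ with $\langle q_k,q_k\rangle=c$ for all $k$, satisfying, for some real multipliers $\mu_k$, $$q_{k+1}+q_{k-1}=\mu_kJ^{-1}q_k,\qquad k\in\mathbb Z .$$ For a spectral parameter $\lambda$ put $$L_k(\lambda)=J^2+\lambda\, Fq_{k-1}\wedge FJq_k-\lambda^2c\; Fq_{k-1}\otimes Fq_{k-1},\qquad A_k(\lambda)=J-\lambda\, Fq_k\otimes Fq_{k-1}.$$ Then for all $k\in\mathbb Z$ the matrix equation $$L_{k+1}(\lambda)=A_k(\lambda)\,L_k(\lambda)\,A_k^{-1}(\lambda)$$ holds (as an identity of rational matrix functions of $\lambda$). Furthermore, there is the matrix factorization $L_k(\lambda)=A_k^T(-\lambda)A_k(\lambda)$, so that the Lax representation can be written as the interchange of factors $$L_{k+1}(\lambda)=A_{k+1}^T(-\lambda)A_{k+1}(\lambda)=A_k(\lambda)A_k^T(-\lambda).$$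
   Context: For column vectors $x,y\in\mathbb C^n$: $x\otimes y=xy^T$ (plain transpose, no complex conjugation) and $x\wedge y=x\otimes y-y\otimes x=xy^T-yx^T$. The notation $A_k^T(-\lambda)$ means the transpose of the matrix $A_k(-\lambda)$. The matrix $A_k(\lambda)$ is invertible over the field of rational functions of $\lambda$ because $A_k(0)=J$ is invertible. *)

(* Defs.v *)
From HB Require Import structures.
From mathcomp Require Import all_boot all_order all_algebra fraction.
From mathcomp Require Import reals complex.

Set Implicit Arguments.
Unset Strict Implicit.
Unset Printing Implicit Defensive.

Import Order.TTheory GRing.Theory Num.Theory.
Local Open Scope ring_scope.

(* Bilinear products of column vectors: no complex conjugation. *)
Definition outer (K : pzRingType) (n : nat) (x y : 'cV[K]_n) : 'M[K]_n :=
  x *m y^T.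

Definition wedge (K : pzRingType) (n : nat) (x y : 'cV[K]_n) : 'M[K]_n :=
  outer x y - outer y x.

(* The rational functions of the spectral parameter are the fraction field of
   C[X], where C = R[i]; the spectral parameter itself is the class of 'X. *)
Definition ratfun (R : realType) := {fraction {poly R[i]}}.

Definition cst_ratfun (R : realType) (z : R[i]) : ratfun R := tofrac z%:P.

Definition spectral (R : realType) : ratfun R := tofrac 'X.

Section Lax.
Variables (R : realType) (k' l' : nat).
Local Notation n := (k' + l')%N.

Definition tau (i : 'I_n) : R := if (i < k')%N then 1 else -1.

Definition pform (x y : 'cV[R]_n) : R := \sum_i tau i * x i 0 * y i 0.

Definition Fmx : 'M[R[i]]_n :=
  diag_mx (\row_i (if (i < k')%N then 1 else 'i%C)).

Variables (c : R) (J : 'M[R]_n) (q : int -> 'cV[R]_n).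

Local Notation JC := (map_mx (real_complex R) J).
Local Notation qC k := (map_mx (real_complex R) (q k)).
Local Notation toRF := (map_mx (@cst_ratfun R)).

Definition laxL (k : int) (lam : ratfun R) : 'M[ratfun R]_n :=
  toRF (JC *m JC)
  + lam *: toRF (wedge (Fmx *m qC (k - 1)) (Fmx *m JC *m qC k))
  - (lam ^+ 2 * cst_ratfun (real_complex R c)) *:
      toRF (outer (Fmx *m qC (k - 1)) (Fmx *m qC (k - 1))).

Definition laxA (k : int) (lam : ratfun R) : 'M[ratfun R]_n :=
  toRF JC - lam *: toRF (outer (Fmx *m qC k) (Fmx *m qC (k - 1))).

End Lax.

(* Main.v *)
(** Put u_k = F q_k, so that u_k^T u_k = c.  Expanding both products, the
    factorization A_k^T(-lambda) A_k(lambda) = L_k(lambda) uses only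
    u_k^T u_k = c, while A_k(lambda) A_k^T(-lambda) equals L_{k+1}(lambda) as
    soon as u_k /\ J (u_{k+1} + u_{k-1}) = 0, which holds because
    J (u_{k+1} + u_{k-1}) = mu_k u_k.  The conjugation form follows by
    multiplying by A_k(lambda)^-1. *)
Require Import Defs.
From HB Require Import structures.
From mathcomp Require Import all_boot all_order all_algebra fraction.
From mathcomp Require Import reals complex.

Set Implicit Arguments.
Unset Strict Implicit.
Unset Printing Implicit Defensive.

Import Order.TTheory GRing.Theory Num.Theory.
Local Open Scope ring_scope.

(** [cst_ratfun] unfolds to this composite; as a ring morphism it lets the [map_mx] lemmas apply. *)
HB.instance Definition _ (R : realType) :=
  GRing.RMorphism.copy (@cst_ratfun R) (@tofrac {poly R[i]} \o polyC).

Section OuterProducts.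
Variables (K : comPzRingType) (n : nat).
Implicit Types (u v w x y : 'cV[K]_n) (J : 'M[K]_n) (a c l : K).

Lemma tr_outer x y : (outer x y)^T = outer y x.
Proof. by rewrite /outer trmx_mul trmxK. Qed.

Lemma mulmx_outer J x y : J *m outer x y = outer (J *m x) y.
Proof. by rewrite /outer mulmxA. Qed.

Lemma outer_mulmx J x y : J^T = J -> outer x y *m J = outer x (J *m y).
Proof. by move=> sJ; rewrite /outer trmx_mul sJ mulmxA. Qed.

Lemma outer_outer c x u y : u^T *m u = c%:M ->
  outer x u *m outer u y = c *: outer x y.
Proof.
by move=> uu; rewrite /outer mulmxA -(mulmxA x) uu mul_mx_scalar scalemxAl.
Qed.

Lemma trmx_linear_pencil J l u v : J^T = J ->
  (J - (- l) *: outer u v)^T = J + l *: outer v u.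
Proof. by move=> sJ; rewrite scaleNr opprK linearD linearZ /= tr_outer sJ. Qed.

(** With u_k, u_(k-1) for [u], [v], the left factor is A_k^T(-lambda). Symmetry of [J] turns the
    linear terms into the wedge; in the quadratic one [u^T *m u] collapses to [c]. *)
Lemma lax_factorization J c l u v : J^T = J -> u^T *m u = c%:M ->
  (J + l *: outer v u) *m (J - l *: outer u v) =
  J *m J + l *: wedge v (J *m u) - (l ^+ 2 * c) *: outer v v.
Proof.
move=> sJ uu; rewrite mulmxDl !mulmxBr -!scalemxAl -!scalemxAr.
rewrite mulmx_outer outer_mulmx // (outer_outer _ _ uu) /wedge !scalerA.
by rewrite scalerBr -expr2 !addrA [_ - _ + _]addrAC.
Qed.

(** Since v /\ v = 0, the multiplier [a] disappears; antisymmetry absorbs the sign. *)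
Lemma wedge_subZ a v x : wedge v (a *: v - x) = wedge x v.
Proof.
rewrite /wedge /outer linearB linearZ /= mulmxBr mulmxBl -scalemxAl -scalemxAr.
by rewrite opprB [LHS]addrC addrA subrK.
Qed.

(** Here [u], [v], [w] stand for u_(k-1), u_k, u_(k+1), so the right side is L_(k+1). *)
Lemma lax_interchange J c a l u v w : J^T = J -> u^T *m u = c%:M ->
  J *m (w + u) = a *: v ->
  (J - l *: outer v u) *m (J + l *: outer u v) =
  J *m J + l *: wedge v (J *m w) - (l ^+ 2 * c) *: outer v v.
Proof.
(* The recurrence is solved for [J *m w], leaving only [u] and [v]. *)
move=> sJ uu; rewrite mulmxDr => /(canRL (addrK _)) ->.
rewrite wedge_subZ mulmxBl !mulmxDr -!scalemxAl -!scalemxAr.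
rewrite mulmx_outer outer_mulmx // (outer_outer _ _ uu) /wedge !scalerA.
by rewrite scalerBr -expr2 opprD !addrA.
Qed.
End OuterProducts.

(** The determinant commutes with evaluation at [a], so it is a nonzero polynomial, and [tofrac] is
    injective. *)
Lemma unitmx_tofrac (D : idomainType) (n : nat) (P : 'M[{poly D}]_n) (a : D) :
  \det (map_mx (horner^~ a) P) != 0 -> map_mx (@tofrac {poly D}) P \in unitmx.
Proof.
(* The same function, in the form that carries a ring morphism structure. *)
rewrite (_ : map_mx (horner^~ a) P = map_mx (horner_eval a) P) //.
rewrite det_map_mx => dP0; rewrite unitmxE unitfE det_map_mx tofrac_eq0.
by apply: contraNneq dP0 => ->; rewrite rmorph0.
Qed.

Lemma map_outer (K K' : pzRingType) (f : {rmorphism K -> K'}) (n : nat)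
    (x y : 'cV[K]_n) : map_mx f (outer x y) = outer (map_mx f x) (map_mx f y).
Proof. by rewrite /outer map_mxM map_trmx. Qed.

Lemma map_wedge (K K' : pzRingType) (f : {rmorphism K -> K'}) (n : nat)
    (x y : 'cV[K]_n) : map_mx f (wedge x y) = wedge (map_mx f x) (map_mx f y).
Proof. by rewrite /wedge map_mxB !map_outer. Qed.

Section LaxMatrices.
Variables (R : realType) (k' l' : nat).
Variables (c : R) (d : 'rV[R]_(k' + l')) (q : int -> 'cV[R]_(k' + l')).
Local Notation J := (diag_mx d).
Local Notation JC := (map_mx (real_complex R) J).
Local Notation qC k := (map_mx (real_complex R) (q k)).
Local Notation toRF := (map_mx (@cst_ratfun R)).
Local Notation cR := (cst_ratfun (real_complex R c)).

Definition rotated_point k := toRF (Fmx R k' l' *m qC k).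
Local Notation u := rotated_point.

Lemma laxAE k lam : laxA J q k lam = toRF JC - lam *: outer (u k) (u (k - 1)).
Proof. by rewrite /laxA map_outer. Qed.

Lemma Fmx_diagC : Fmx R k' l' *m JC = JC *m Fmx R k' l'.
Proof. by rewrite /Fmx map_diag_mx diag_mxC. Qed.

Lemma laxLE k lam : laxL c J q k lam =
  toRF JC *m toRF JC + lam *: wedge (u (k - 1)) (toRF JC *m u k)
  - (lam ^+ 2 * cR) *: outer (u (k - 1)) (u (k - 1)).
Proof.
have mapJJ : toRF (JC *m JC) = toRF JC *m toRF JC by rewrite map_mxM.
have mapW : toRF (wedge (Fmx R k' l' *m qC (k - 1)) (Fmx R k' l' *m JC *m qC k))
    = wedge (u (k - 1)) (toRF JC *m u k).
  by rewrite map_wedge Fmx_diagC -mulmxA [X in wedge _ X]map_mxM.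
have mapO := map_outer (@cst_ratfun R) (Fmx R k' l' *m qC (k - 1))
  (Fmx R k' l' *m qC (k - 1)).
by rewrite /laxL mapJJ mapW mapO.
Qed.

Lemma tr_toRF_diag : (toRF JC)^T = toRF JC.
Proof. by rewrite !map_diag_mx tr_diag_mx. Qed.

(** The squared diagonal entries of F are the signs [tau], so F turns the indefinite form into the
    plain bilinear one. *)
Lemma rotated_point_norm k : pform (q k) (q k) = c ->
  (u k)^T *m u k = cR%:M.
Proof.
move=> <-; rewrite /u map_trmx -map_mxM -map_scalar_mx; congr map_mx.
rewrite [LHS]mx11_scalar; congr _%:M.
rewrite mxE /pform rmorph_sum; apply: eq_bigr => i _.
rewrite /Fmx !mul_diag_mx !mxE /tau.
case: ifP => _; first by rewrite !mul1r rmorphM.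
by rewrite mulrACA -expr2 sqr_i !mulN1r mulNr rmorphN rmorphM.
Qed.

(** J commutes with F, so it reaches J^-1 q_k and cancels the inverse. *)
Lemma rotated_point_recurrence k m : (forall i, d 0 i != 0) ->
  q (k + 1) + q (k - 1) = m *: (invmx J *m q k) ->
  toRF JC *m (u (k + 1) + u (k - 1)) = cst_ratfun (real_complex R m) *: u k.
Proof.
move=> hd hq; have uJ : J \in unitmx.
  by rewrite unitmxE unitfE det_diag prodf_seq_neq0; apply/allP => i _; apply: hd.
rewrite /u -map_mxD -mulmxDr -map_mxD -map_mxM mulmxA -Fmx_diagC.
by rewrite -mulmxA -map_mxM hq -scalemxAr mulKVmx // map_mxZ -scalemxAr map_mxZ.
Qed.

Lemma laxA_unit k : (forall i, d 0 i != 0) ->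
  laxA J q k (spectral R) \in unitmx.
Proof.
move=> hd; set o := outer (Fmx R k' l' *m qC k) (Fmx R k' l' *m qC (k - 1)).
(* The matrix is lifted to polynomial entries, to be evaluated at 0, where only J remains. *)
have -> : laxA J q k (spectral R) =
    map_mx (@tofrac {poly R[i]}) (map_mx polyC JC - 'X *: map_mx polyC o).
  by rewrite map_mxB map_mxZ /laxA -!map_mx_comp.
apply: (@unitmx_tofrac _ _ _ 0).
rewrite (_ : map_mx _ _ = JC); last first.
  by move: (JC) o => M o; apply/matrixP=> i j; rewrite !mxE !hornerE subr0.
rewrite det_map_mx fmorph_eq0 det_diag prodf_seq_neq0.
by apply/allP => i _; apply: hd.
Qed.
End LaxMatrices.

Theorem theorem3p1 (R : realType) (k' l' : nat)
    (k'_ge1 : (1 <= k')%N) (l'_ge1 : (1 <= l')%N)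
    (c : R) (hc : c \in [:: 1; -1; 0])
    (d : 'rV[R]_(k' + l')) (hd : forall i, d 0 i != 0)
    (q : int -> 'cV[R]_(k' + l'))
    (hq : forall k : int, pform (q k) (q k) = c)
    (mu : int -> R)
    (hmu : forall k : int,
        q (k + 1) + q (k - 1) = mu k *: (invmx (diag_mx d) *m q k)) :
  let J := diag_mx d in
  let lam := spectral R in
  let L := laxL c J q in
  let A := laxA J q in
  forall k : int,
    [/\ A k lam \in unitmx,
        L (k + 1) lam = A k lam *m L k lam *m invmx (A k lam),
        L k lam = (A k (- lam))^T *m A k lam,
        L (k + 1) lam = (A (k + 1) (- lam))^T *m A (k + 1) lam
      & (A (k + 1) (- lam))^T *m A (k + 1) lam
          = A k lam *m (A k (- lam))^T].
Proof.
move=> J lam L A k.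
have factor m : L m lam = (A m (- lam))^T *m A m lam.
  rewrite /L /A laxLE !laxAE trmx_linear_pencil ?tr_toRF_diag //.
  by rewrite (lax_factorization _ _ (tr_toRF_diag d)
                (rotated_point_norm (hq m))).
have swap : L (k + 1) lam = A k lam *m (A k (- lam))^T.
  (* [addrK] reduces the index k + 1 - 1 in L_(k+1) to k. *)
  rewrite /L /A laxLE !laxAE trmx_linear_pencil ?tr_toRF_diag // addrK.
  by rewrite (lax_interchange _ (tr_toRF_diag d) (rotated_point_norm (hq (k - 1)))
                (rotated_point_recurrence hd (hmu k))).
have uA : A k lam \in unitmx by apply: laxA_unit.
(* In the conjugation, factoring L_k puts A_k next to its inverse, leaving the interchanged
   product. *)
by split=> //; rewrite -?factor // swap factor mulmxA mulmxK.
Qed.
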